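(* Let $f\colon \mathbb{R}^d_{\ge}\to\mathbb{R}_{\ge}$ be a size function for ellipsoids such that $f\circ w^{1/2}$ is strictly concave on $\mathbb{R}^d_{\ge}$. Let $F\subset\mathbb{R}^d$ be a compact convex body and let $c\in F$. Then among all ellipsoids with center $c$ that are inscribed into (i.e. contained in) $F$ there exists a unique ellipsoid that is maximal with respect to $f$; that is, there is exactly one ellipsoid $E\subset F$ with center $c$ such that $f(E')\le f(E)$ for every ellipsoid $E'\subset F$ with center $c$.
   Context: $\mathbb{R}_{\ge}$ denotes the non-negative reals and $\mathbb{R}^d_{\ge}$ the vectors in $\mathbb{R}^d$ with all entries in $\mathbb{R}_{\ge}$. A convex body is a compact convex set with non-empty interior. An ellipsoid in $\mathbb{R}^d$ with center $t\in\mathbb{R}^d$ is a set of the form $E=\{P\cdot x+t : x\in\mathbb{R}^d,\ \|x\|\le 1\}$ with $P\in\mathbb{R}^{d\times d}$, where $\|\cdot\|$ is the Euclidean norm. Degenerate ellipsoids (with $P$ singular, hence with empty interior) are admitted. By the polar decomposition one may always choose $P$ symmetric and positive semi-definite; the semi-axis lengths of $E$ are then the eigenvalues of $P$. A function $f\colon\mathbb{R}^d_{\ge}\to\mathbb{R}_{\ge}$ is called a size function for ellipsoids if it is continuous, strictly monotone increasing in each of its arguments, and symmetric (i.e. $f(y)=f(x)$ whenever $y$ is a permutation of $x$). For an ellipsoid $E$, $f(E)$ denotes the value of $f$ at the vector of semi-axis lengths of $E$. For $p\in\mathbb{R}$, $w^p$ is the map $(x_1,\dots,x_d)^T\mapsto(|x_1|^p,\dots,|x_d|^p)^T$;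 in particular $w^{1/2}(x)=(\sqrt{x_1},\dots,\sqrt{x_d})^T$ on $\mathbb{R}^d_{\ge}$. *)

(* Defs.v *)
From HB Require Import structures.
From mathcomp Require Import all_boot all_order all_fingroup all_algebra.
From mathcomp Require Import all_classical all_reals all_analysis.

Set Implicit Arguments.
Unset Strict Implicit.
Unset Printing Implicit Defensive.

Import Order.TTheory GRing.Theory Num.Theory.
Import numFieldNormedType.Exports.

Local Open Scope classical_set_scope.
Local Open Scope ring_scope.

Definition nneg_orthant (R : realType) (d : nat) : set 'cV[R]_d :=
  [set x | forall i, 0 <= x i 0].

(* The library norm on 'cV[R]_d is the sup norm; it induces the usual topology
   but not the Euclidean unit ball. *)
Definition enorm (R : realType) (d : nat) (x : 'cV[R]_d) : R :=
  Num.sqrt (\sum_i x i 0 ^+ 2).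

Definition convex_body (R : realType) (d : nat) (F : set 'cV[R]_d) : Prop :=
  [/\ compact F,
      convex_set (F : set (convex_lmodType 'cV[R]_d)) &
      interior F !=set0].

(* P is arbitrary, possibly singular. *)
Definition ellipsoid (R : realType) (d : nat) (P : 'M[R]_d) (t : 'cV[R]_d) :
    set 'cV[R]_d :=
  [set P *m x + t | x in [set x | enorm x <= 1]].

Definition is_ellipsoid (R : realType) (d : nat) (t : 'cV[R]_d)
    (E : set 'cV[R]_d) : Prop :=
  exists P : 'M[R]_d, E = ellipsoid P t.

Definition psdmx (R : realType) (d : nat) (P : 'M[R]_d) : Prop :=
  P^T = P /\ forall x : 'cV[R]_d, 0 <= (x^T *m P *m x) 0 0.

(* a lists the eigenvalues, with multiplicity, of a symmetric positive
   semi-definite matrix representing E. *)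
Definition is_semi_axes (R : realType) (d : nat) (E : set 'cV[R]_d)
    (a : 'cV[R]_d) : Prop :=
  exists (P : 'M[R]_d) (t : 'cV[R]_d),
    [/\ psdmx P, E = ellipsoid P t &
        char_poly P = \prod_i ('X - (a i 0)%:P)].

(* Semi-axis lengths are determined by the ellipsoid only up to order; an
   ordering is chosen, which is immaterial for symmetric functions. *)
Definition semi_axes (R : realType) (d : nat) (E : set 'cV[R]_d) : 'cV[R]_d :=
  xget 0 (is_semi_axes E).

(* Only the values of f on the non-negative orthant are constrained. *)
Definition size_function (R : realType) (d : nat) (f : 'cV[R]_d -> R) : Prop :=
  [/\ forall x, nneg_orthant x -> 0 <= f x,
      {within @nneg_orthant R d, continuous f},
      forall x y i, nneg_orthant x -> nneg_orthant y ->
        (forall j, j != i -> x j 0 = y j 0) -> x i 0 < y i 0 -> f x < f y &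
      forall x (s : 'S_d), nneg_orthant x -> f (row_perm s x) = f x].

Definition ellipsoid_size (R : realType) (d : nat) (f : 'cV[R]_d -> R)
    (E : set 'cV[R]_d) : R :=
  f (semi_axes E).

Definition wpow (R : realType) (d : nat) (p : R) (x : 'cV[R]_d) : 'cV[R]_d :=
  \col_i (`|x i 0| `^ p).

Definition strictly_concave_on (R : realType) (d : nat) (D : set 'cV[R]_d)
    (g : 'cV[R]_d -> R) : Prop :=
  forall (x y : 'cV[R]_d) (t : R), D x -> D y -> x <> y -> 0 < t -> t < 1 ->
    t * g x + (1 - t) * g y < g (t *: x + (1 - t) *: y).

(* Main.v *)
Require Import Defs.
From HB Require Import structures.
From mathcomp Require Import all_boot all_order all_fingroup all_algebra.
From mathcomp Require Import all_classical all_reals all_analysis.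
From mathcomp Require Import ring lra.

Import Order.TTheory GRing.Theory Num.Theory.
Import numFieldNormedType.Exports.

Local Open Scope classical_set_scope.
Local Open Scope ring_scope.

Set Implicit Arguments.
Unset Strict Implicit.
Unset Printing Implicit Defensive.

(** An ellipsoid with centre [c] is the image of the unit ball under
    [x |-> P x + c], and it depends on [P] only through the Gram matrix
    [P P^T]: its support function is [u |-> u.c + sqrt (u.(P P^T) u)]
    ([ellipsoid_gram], [ellipsoid_inj]).  The squared semi-axis lengths are the
    eigenvalues of [P P^T] ([ellipsoid_size_gram]), so the problem is to
    maximise [g], evaluated at these eigenvalues, over the Gram matrices of
    inscribed ellipsoids, where [g x = f (sqrt x)] is strictly concave.

    The heart of the matter is Davis' theorem: a symmetric strictly concave
    function of the eigenvalues is a strictly concave function of the matrix.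
    It enters through a variational description: for [A] positive
    semi-definite, [g (eigenvalues of A)] is the minimum of [g] at the diagonal
    of [Q^T A Q] over all orthogonal [Q], and every minimiser diagonalises [A]
    ([exists_diag_minimizer], [diag_minimizer]).  Indeed, if [Q^T A Q] has a
    nonzero entry off the diagonal at [(i, j)], a reflection in the plane of
    the coordinates [i] and [j] spreads the two diagonal entries apart while
    keeping their sum ([diag_spread]).  The old diagonal is then a proper
    convex combination of the new one and of the new one with [i] and [j]
    exchanged, and strict concavity with symmetry makes [g] strictly smaller at
    the new diagonal ([diag_spread_lt]).  This argument also yields the
    spectral theorem that is needed ([psd_diagonalizable]).

    Existence: inscribed ellipsoids are parametrised by pairs [(U, a)], with
    [U] orthogonal carrying the axes and [a] the lengths up to sign; these pairs
    form a compact set on which the size is continuous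
    ([exists_maximal_parameters]).  This avoids the continuity of eigenvalues.

    Uniqueness: let [A1], [A2] be the Gram matrices of two maximal ellipsoids.
    The ellipsoid with Gram matrix [A = (A1 + A2) / 2] is still inscribed
    ([mean_ellipsoid_sub]).  Choose [U] diagonalising [A]; the eigenvalue
    vector of [A] is the mean of the diagonals [b1], [b2] of [U^T A1 U] and
    [U^T A2 U], and [g] at [bk] is at least the maximal size.  Were [b1] and
    [b2] different, the mean ellipsoid would be strictly larger than the
    maximum.  So [b1 = b2], [U] is a minimiser for both [A1] and [A2], hence
    diagonalises both, and [A1 = A2]. *)

(** * Quadratic forms and positive semi-definite matrices *)

Definition dotv (R : realType) d (u v : 'cV[R]_d) : R := (u^T *m v) 0 0.

Definition orthomx (R : realType) d (U : 'M[R]_d) : Prop := U^T *m U = 1%:M.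

Definition dmx (R : realType) d (a : 'cV[R]_d) : 'M[R]_d := diag_mx a^T.

Definition diagv (R : realType) d (M : 'M[R]_d) : 'cV[R]_d := \col_i M i i.

Section QuadraticForms.
Variable R : realType.

Lemma dotvE d (u v : 'cV[R]_d) : dotv u v = \sum_i u i 0 * v i 0.
Proof. by rewrite /dotv mxE; apply: eq_bigr => i _; rewrite mxE. Qed.

Lemma dotvC d (u v : 'cV[R]_d) : dotv u v = dotv v u.
Proof. by rewrite !dotvE; apply: eq_bigr => i _; rewrite mulrC. Qed.

Lemma dotvDl d (u v w : 'cV[R]_d) : dotv (u + v) w = dotv u w + dotv v w.
Proof. by rewrite /dotv linearD mulmxDl mxE. Qed.

Lemma dotvDr d (u v w : 'cV[R]_d) : dotv w (u + v) = dotv w u + dotv w v.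
Proof. by rewrite /dotv mulmxDr mxE. Qed.

Lemma dotvZl d k (u w : 'cV[R]_d) : dotv (k *: u) w = k * dotv u w.
Proof. by rewrite /dotv linearZ -scalemxAl mxE. Qed.

Lemma dotvZr d k (u w : 'cV[R]_d) : dotv w (k *: u) = k * dotv w u.
Proof. by rewrite /dotv -scalemxAr mxE. Qed.

Lemma dotv_mulmxl m n (P : 'M[R]_(m, n)) u v :
  dotv (P *m u) v = dotv u (P^T *m v).
Proof. by rewrite /dotv trmx_mul mulmxA. Qed.

Lemma dotv_ge0 d (u : 'cV[R]_d) : 0 <= dotv u u.
Proof. by rewrite dotvE sumr_ge0 // => i _; rewrite -expr2 sqr_ge0. Qed.

Lemma dotv_eq0 d (u : 'cV[R]_d) : dotv u u = 0 -> u = 0.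
Proof.
rewrite dotvE => /eqP; rewrite psumr_eq0 => [/allP u0|i _]; last first.
  by rewrite -expr2 sqr_ge0.
apply/colP => i; rewrite mxE; apply/eqP.
by have := u0 i (mem_index_enum i); rewrite mulf_eq0 orbb.
Qed.

Lemma enorm_le1 d (u : 'cV[R]_d) : (enorm u <= 1) = (dotv u u <= 1).
Proof.
have -> : enorm u = Num.sqrt (dotv u u).
  by rewrite /enorm dotvE; congr Num.sqrt; apply: eq_bigr => i _; rewrite expr2.
by rewrite -{1}sqrtr1 ler_sqrt.
Qed.

Lemma CauchySchwarz_dotv d (u v : 'cV[R]_d) :
  dotv u v ^+ 2 <= dotv u u * dotv v v.
Proof.
have [v0|v_neq0] := eqVneq (dotv v v) 0.
  by rewrite v0 (dotv_eq0 v0) /dotv mulmx0 mxE expr0n mulr0.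
have vv_gt0 : 0 < dotv v v by rewrite lt_def v_neq0 dotv_ge0.
rewrite -(ler_pM2r vv_gt0) -subr_ge0.
have := dotv_ge0 (dotv v v *: u - dotv u v *: v).
rewrite -scaleNr !(dotvDl, dotvDr, dotvZl, dotvZr) (dotvC v u) => h.
by apply: le_trans h _; lra.
Qed.

Lemma mulmx_tr_eq0 m n (X : 'M[R]_(m, n)) : X *m X^T = 0 -> X = 0.
Proof.
move=> X0; apply/matrixP => i j; rewrite mxE.
have : \sum_k X i k ^+ 2 = 0.
  move/matrixP: X0 => /(_ i i); rewrite !mxE => X0i.
  by rewrite -[RHS]X0i; apply: eq_bigr => k _; rewrite mxE expr2.
move/eqP; rewrite psumr_eq0 => [/allP X0i|k _]; last exact: sqr_ge0.
by have := X0i j (mem_index_enum j); rewrite sqrf_eq0 => /eqP.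
Qed.

Lemma dotv_delta m n (M : 'M[R]_(m, n)) i j :
  dotv (delta_mx i 0) (M *m delta_mx j 0) = M i j.
Proof. by rewrite /dotv trmx_delta -rowE -colE !mxE. Qed.

(** By polarisation. *)
Lemma form_eq0 d (S : 'M[R]_d) : S^T = S ->
  (forall u, dotv u (S *m u) = 0) -> S = 0.
Proof.
move=> symS S0; apply: trmx_inj; rewrite trmx0 symS.
have S0uv u v : dotv u (S *m v) = 0.
  have := S0 (u + v); rewrite mulmxDr !(dotvDl, dotvDr) !S0.
  have -> : dotv v (S *m u) = dotv u (S *m v).
    by rewrite dotvC dotv_mulmxl symS.
  lra.
apply/matrixP => i j; have := S0uv (delta_mx i 0) (delta_mx j 0).
by rewrite dotv_delta !mxE.
Qed.

(** A nonnegative form has no first-order change at a zero [x]; moving from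
    [x] in the direction [- P x] would otherwise make the form negative. *)
Lemma psd_ker d (P : 'M[R]_d) x : psdmx P -> dotv x (P *m x) = 0 -> P *m x = 0.
Proof.
move=> [symP posP] Px0; set y := P *m x.
have pos z : 0 <= dotv z (P *m z) by rewrite /dotv mulmxA; exact: posP.
have [//|/eqP y_neq0] := eqVneq y 0.
have yy_gt0 : 0 < dotv y y.
  by rewrite lt_def dotv_ge0 andbT; apply/eqP => /dotv_eq0.
set q := dotv y (P *m y); have q_ge0 : 0 <= q := pos y.
(* A step with [s * q < dotv y y], safe also when [q = 0]. *)
pose s := dotv y y / (q + 1).
have q1 : q + 1 != 0 by rewrite gt_eqF // ltr_wpDl.
have s_gt0 : 0 < s by rewrite divr_gt0 // ltr_wpDl.
have sE : s * q = dotv y y - s by rewrite /s; field.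
have := pos (x - s *: y).
have xPy : dotv x (P *m y) = dotv y y by rewrite /y dotv_mulmxl symP.
rewrite -scaleNr mulmxDr -scalemxAr !(dotvDl, dotvDr, dotvZl, dotvZr) -/q.
rewrite Px0 xPy -/y.
rewrite (_ : _ + _ = - s * (dotv y y + s)); last first.
  have -> : - s * (- s * q) = s * (s * q) by ring.
  by rewrite sE; ring.
have ys_gt0 : 0 < dotv y y + s by rewrite addr_gt0.
by rewrite pmulr_lge0 // oppr_ge0 leNgt s_gt0.
Qed.

(** With [N = P - Q] one has [N P + Q N = 0], so the traces of [N P N] and
    [N Q N] add up to zero.  Both matrices are positive semi-definite, hence
    [P] and [Q] vanish on the range of [N], and [N N = 0]. *)
Lemma psd_sqrt_inj d (P Q : 'M[R]_d) :
  psdmx P -> psdmx Q -> P *m P = Q *m Q -> P = Q.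
Proof.
move=> psdP psdQ PQ; have [symP posP] := psdP; have [symQ posQ] := psdQ.
set N := P - Q.
have symN : N^T = N by rewrite /N linearB /= symP symQ.
have NPQ : N *m P + Q *m N = 0.
  by rewrite /N mulmxBl mulmxBr PQ addrA subrK subrr.
have tr0 : \tr (N *m (P *m N)) + \tr (N *m (Q *m N)) = 0.
  rewrite mulmxA (mxtrace_mulC N (Q *m N)) -mxtraceD -mulmxDl NPQ.
  by rewrite mul0mx mxtrace0.
have entry S i : (N *m (S *m N)) i i = dotv (col i N) (S *m col i N).
  by rewrite colE dotv_mulmxl symN !mulmxA dotv_delta.
have pos S : psdmx S -> forall i, 0 <= (N *m (S *m N)) i i.
  by move=> [_ posS] i; rewrite entry /dotv mulmxA; exact: posS.
have ker S : psdmx S -> \tr (N *m (S *m N)) = 0 -> S *m N = 0.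
  move=> psdS /eqP; rewrite psumr_eq0 => [/allP S0|i _]; last exact: pos.
  apply/matrixP => k i; have /eqP := S0 i (mem_index_enum i).
  rewrite entry => /(psd_ker psdS); rewrite colE mulmxA -colE.
  by move=> /colP /(_ k); rewrite !mxE.
have trP_ge0 : 0 <= \tr (N *m (P *m N)) by apply: sumr_ge0 => i _; exact: pos.
have trQ_ge0 : 0 <= \tr (N *m (Q *m N)) by apply: sumr_ge0 => i _; exact: pos.
have NN0 : N *m N = 0.
  have PN0 : P *m N = 0 by apply: ker => //; lra.
  have QN0 : Q *m N = 0 by apply: ker => //; lra.
  by rewrite {1}/N mulmxBl PN0 QN0 subrr.
by apply/eqP; rewrite -subr_eq0; apply/eqP/mulmx_tr_eq0; rewrite symN.
Qed.

Lemma orthomx_tr d (U : 'M[R]_d) : orthomx U -> U *m U^T = 1%:M.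
Proof. exact: mulmx1C. Qed.

Lemma orthomxM d (U V : 'M[R]_d) : orthomx U -> orthomx V -> orthomx (U *m V).
Proof.
by move=> oU oV; rewrite /orthomx trmx_mul mulmxA -(mulmxA V^T) oU mulmx1 oV.
Qed.

Lemma orthomx_dotv d (U : 'M[R]_d) x :
  orthomx U -> dotv (U *m x) (U *m x) = dotv x x.
Proof. by move=> oU; rewrite dotv_mulmxl mulmxA oU mul1mx. Qed.

Lemma tr_dmx d (a : 'cV[R]_d) : (dmx a)^T = dmx a.
Proof. exact: tr_diag_mx. Qed.

Lemma dmxM d (a b : 'cV[R]_d) : dmx a *m dmx b = dmx (\col_i (a i 0 * b i 0)).
Proof.
by rewrite /dmx mulmx_diag; congr diag_mx; apply/rowP => i; rewrite !mxE.
Qed.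

Lemma is_diag_dmx d (M : 'M[R]_d) : is_diag_mx M -> M = dmx (diagv M).
Proof.
move/is_diag_mxP => M0; apply/matrixP => i j; rewrite !mxE.
by have [->|/M0] := eqVneq i j; rewrite ?mulr1n ?mulr0n.
Qed.

Lemma dmx_mulmx d (a z : 'cV[R]_d) i : (dmx a *m z) i 0 = a i 0 * z i 0.
Proof. by rewrite mul_diag_mx !mxE. Qed.

Lemma psd_gram d m (P : 'M[R]_(d, m)) : psdmx (P *m P^T).
Proof.
split=> [|x]; first by rewrite trmx_mul trmxK.
rewrite mulmxA -mulmxA -[x^T *m P]trmxK trmx_mul trmxK.
exact: dotv_ge0.
Qed.

Lemma psd_conj d m (A : 'M[R]_d) (Q : 'M[R]_(d, m)) :
  psdmx A -> psdmx (Q^T *m A *m Q).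
Proof.
move=> [symA posA]; split=> [|x]; first by rewrite !trmx_mul symA trmxK mulmxA.
by have := posA (Q *m x); rewrite trmx_mul !mulmxA.
Qed.

Lemma psd_diagv d (A : 'M[R]_d) : psdmx A -> nneg_orthant (diagv A).
Proof.
move=> [_ posA] i; have := posA (delta_mx i 0).
by rewrite -mulmxA -/(dotv _ _) dotv_delta mxE.
Qed.

End QuadraticForms.

(** * An ellipsoid is determined by its centre and Gram matrix *)

Section EllipsoidGram.
Variable R : realType.

(** A matrix and its transpose have the same operator norm: apply
    Cauchy-Schwarz to [|B x|^2 = x.(B^T B x)]. *)
Lemma tr_contraction m n (B : 'M[R]_(m, n)) :
  (forall y, dotv (B^T *m y) (B^T *m y) <= dotv y y) ->
  forall x, dotv (B *m x) (B *m x) <= dotv x x.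
Proof.
move=> contrB x; set y := B *m x.
have [->|y_neq0] := eqVneq (dotv y y) 0; first exact: dotv_ge0.
have y_gt0 : 0 < dotv y y by rewrite lt_def y_neq0 dotv_ge0.
have := CauchySchwarz_dotv x (B^T *m y); rewrite -dotv_mulmxl -/y.
have := contrB y; have := dotv_ge0 x => x_ge0 le1 le2.
rewrite -(ler_pM2r y_gt0) -expr2; apply: (le_trans le2).
by rewrite ler_wpM2l.
Qed.

(** The matrix [P] may be rectangular, so that sums of ellipsoids are covered.
    In the basis [U], [P] factors as [diag a] times a partial isometry [B],
    obtained by dividing the rows of [U^T P] by the entries of [a]; both [B]
    and its transpose are contractions, and [P B^T = U diag a]. *)
Lemma ball_image_gram d m (P : 'M[R]_(d, m)) (U : 'M[R]_d) (a : 'cV[R]_d) :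
  orthomx U -> U^T *m (P *m P^T) *m U = dmx a *m dmx a ->
  [set P *m x | x in [set x | enorm x <= 1]] =
  [set U *m dmx a *m z | z in [set z | enorm z <= 1]].
Proof.
move=> oU gramP; set D := dmx a in gramP *.
(* Since [0^-1 = 0], [Di] is the pseudo-inverse of [D]. *)
set N := U^T *m P; pose Di := dmx (\col_i (a i 0)^-1); pose B := Di *m N.
have UN : U *m N = P by rewrite mulmxA orthomx_tr // mul1mx.
have NN : N *m N^T = D *m D by rewrite -gramP trmx_mul trmxK !mulmxA.
have DDiD : D *m Di *m D = D.
  rewrite !dmxM /D; congr dmx; apply/colP => i; rewrite !mxE.
  by have [->|a0] := eqVneq (a i 0) 0; rewrite ?mulr0 // mulfV ?mul1r.
have DB : D *m B = N.
  apply/eqP; rewrite eq_sym -subr_eq0; apply/eqP/mulmx_tr_eq0.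
  rewrite (_ : N - D *m B = (1%:M - D *m Di) *m N); last first.
    by rewrite mulmxBl mul1mx mulmxA.
  rewrite trmx_mul mulmxA -(mulmxA _ N) NN mulmxA mulmxBl mul1mx DDiD subrr.
  by rewrite !mul0mx.
have BB : B *m B^T = Di *m D *m (D *m Di).
  by rewrite trmx_mul tr_dmx !mulmxA -(mulmxA _ N) NN !mulmxA.
have contrB y : dotv (B^T *m y) (B^T *m y) <= dotv y y.
  rewrite dotv_mulmxl trmxK mulmxA BB !dmxM !dotvE; apply: ler_sum => i _.
  rewrite dmx_mulmx !mxE.
  have [->|a0] := eqVneq (a i 0) 0.
    by rewrite !(mulr0, mul0r) -expr2 sqr_ge0.
  by rewrite mulVf // mulfV // !mul1r.
apply/seteqP; split=> _ [x /= x1 <-].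
  exists (B *m x); last by rewrite -mulmxA (mulmxA D) DB mulmxA UN.
  move: x1; rewrite !enorm_le1; apply: le_trans.
  exact: tr_contraction.
exists (B^T *m x); first by move: x1; rewrite !enorm_le1; apply: le_trans.
have PB : P *m B^T = U *m D.
  rewrite -[P in LHS]UN -DB -(mulmxA U) -(mulmxA D B) BB; congr (U *m _).
  rewrite !dmxM; congr dmx; apply/colP => i; rewrite !mxE.
  by have [->|a0] := eqVneq (a i 0) 0; rewrite ?mul0r // mulVf // mulfV ?mulr1.
by rewrite (mulmxA P) PB.
Qed.

Lemma ellipsoid_gram d (P U : 'M[R]_d) (a c : 'cV[R]_d) :
  orthomx U -> U^T *m (P *m P^T) *m U = dmx a *m dmx a ->
  ellipsoid P c = ellipsoid (U *m dmx a) c.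
Proof.
move=> oU gramP; have := ball_image_gram oU gramP => /seteqP [sub1 sub2].
apply/seteqP; split=> _ [x /= x1 <-].
  by have [|z z1 <-] := sub1 (P *m x); [exists x|exists z].
by have [|z z1 <-] := sub2 (U *m dmx a *m x); [exists x|exists z].
Qed.

(** Inclusion implies comparison of support functions.  The support point of
    the smaller set in the direction [u] is written down explicitly, and for the
    larger set the Cauchy-Schwarz bound is enough. *)
Lemma ellipsoid_support_le d (P Q : 'M[R]_d) (s t : 'cV[R]_d) :
  ellipsoid P t `<=` ellipsoid Q s -> forall u,
  dotv u t + Num.sqrt (dotv u (P *m P^T *m u)) <=
  dotv u s + Num.sqrt (dotv u (Q *m Q^T *m u)).
Proof.
move=> subPQ u; set p := dotv u (P *m P^T *m u).
have pE : p = dotv (P^T *m u) (P^T *m u) by rewrite dotv_mulmxl trmxK mulmxA.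
have p_ge0 : 0 <= p by rewrite pE dotv_ge0.
pose x := (Num.sqrt p)^-1 *: (P^T *m u).
have x1 : enorm x <= 1.
  rewrite enorm_le1 dotvZl dotvZr -pE mulrA -expr2 exprVn sqr_sqrtr //.
  by have [->|p0] := eqVneq p 0; rewrite ?mulr0 // mulVf.
have ux : dotv u (P *m x) = Num.sqrt p.
  rewrite -scalemxAr dotvZr mulmxA -/p -{2}[p]sqr_sqrtr //.
  have [->|p0] := eqVneq (Num.sqrt p) 0; first by rewrite expr0n mulr0.
  by rewrite expr2 mulKf.
have [|y /= y1 /(congr1 (dotv u))] := subPQ (P *m x + t); first by exists x.
rewrite !dotvDr ux => yE; rewrite addrC -yE addrC lerD2l.
have := CauchySchwarz_dotv (Q^T *m u) y.
rewrite dotv_mulmxl trmxK [dotv (Q^T *m u) _]dotv_mulmxl trmxK mulmxA.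
set q := dotv u (Q *m Q^T *m u) => le_q.
have q_ge0 : 0 <= q by rewrite /q -mulmxA -[Q]trmxK -dotv_mulmxl trmxK dotv_ge0.
apply: le_trans (ler_norm _) _; rewrite -sqrtr_sqr ler_sqrt //.
apply: le_trans le_q _; rewrite -[leRHS]mulr1 ler_wpM2l //.
by rewrite -enorm_le1.
Qed.

(** The odd part of the support function determines the centre and the even
    part the quadratic form of the Gram matrix. *)
Lemma ellipsoid_inj d (P Q : 'M[R]_d) (s t : 'cV[R]_d) :
  ellipsoid P t = ellipsoid Q s -> t = s /\ P *m P^T = Q *m Q^T.
Proof.
move=> /seteqP [PQ QP].
have supp u : dotv u t + Num.sqrt (dotv u (P *m P^T *m u)) =
              dotv u s + Num.sqrt (dotv u (Q *m Q^T *m u)).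
  by apply/eqP; rewrite eq_le !ellipsoid_support_le.
have suppN u : - dotv u t + Num.sqrt (dotv u (P *m P^T *m u)) =
               - dotv u s + Num.sqrt (dotv u (Q *m Q^T *m u)).
  have := supp (-1 *: u); rewrite -!scalemxAr !(dotvZl, dotvZr).
  by rewrite !mulrA mulrNN !mul1r !mulN1r.
split.
  apply/eqP; rewrite -subr_eq0; apply/eqP/dotv_eq0; set w := t - s.
  rewrite -[X in dotv w X]/(t - s) -scaleN1r dotvDr dotvZr.
  have := supp w; have := suppN w; lra.
apply/eqP; rewrite -subr_eq0; apply/eqP/form_eq0.
  by rewrite linearB /= !trmx_mul !trmxK.
move=> u; rewrite mulmxBl -scaleN1r dotvDr dotvZr.
have := ((psd_gram P).2 u, (psd_gram Q).2 u).
rewrite -!(mulmxA u^T) => -[p_ge0 q_ge0].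
rewrite -[X in X + _]sqr_sqrtr // -[X in _ + -1 * X]sqr_sqrtr //.
have -> : Num.sqrt (dotv u (P *m P^T *m u)) = Num.sqrt (dotv u (Q *m Q^T *m u)).
  by have := supp u; have := suppN u; lra.
by rewrite mulN1r subrr.
Qed.

Lemma gram_dmx d (U : 'M[R]_d) a : orthomx U ->
  U^T *m ((U *m dmx a) *m (U *m dmx a)^T) *m U = dmx a *m dmx a.
Proof.
move=> oU; rewrite trmx_mul tr_dmx !mulmxA oU mul1mx.
by rewrite -[LHS]mulmxA oU mulmx1.
Qed.

Lemma convex_set_comb d (F : set 'cV[R]_d) x y (l : R) :
  convex_set (F : set (convex_lmodType 'cV[R]_d)) ->
  F x -> F y -> 0 <= l -> l <= 1 -> F (l *: x + (1 - l) *: y).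
Proof.
move=> cvF Fx Fy l0 l1.
by have := cvF x y (Itv01 l0 l1); rewrite !inE; apply.
Qed.

(** The case [k = 0], where no division is possible, forces [s *: x = 0]. *)
Lemma rescale_ball d (x : 'cV[R]_d) (s k : R) : 0 <= s ->
  s * Num.sqrt (dotv x x) <= k -> exists2 y, enorm y <= 1 & s *: x = k *: y.
Proof.
move=> s_ge0 le_k; have n_ge0 := sqrtr_ge0 (dotv x x).
have k_ge0 : 0 <= k by apply: le_trans le_k; rewrite mulr_ge0.
have [k0|k_neq0] := eqVneq k 0.
  exists 0; first by rewrite enorm_le1 /dotv mulmx0 mxE.
  rewrite scaler0; have : s * Num.sqrt (dotv x x) = 0.
    by apply/eqP; rewrite eq_le mulr_ge0 // -{1}k0 le_k.
  move/eqP; rewrite mulf_eq0 => /orP [/eqP ->|]; first by rewrite scale0r.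
  rewrite sqrtr_eq0 => xx; rewrite (dotv_eq0 (u := x)) ?scaler0 //.
  by apply/eqP; rewrite eq_le xx dotv_ge0.
exists (k^-1 *: (s *: x)); last by rewrite scalerA mulfV // scale1r.
rewrite enorm_le1 !(dotvZl, dotvZr) -[dotv x x]sqr_sqrtr ?dotv_ge0 //.
set n := Num.sqrt _ in le_k n_ge0 *.
rewrite (_ : _ * _ = (s * n / k) ^+ 2); last by field.
by rewrite expr_le1 ?divr_ge0 ?mulr_ge0 // ler_pdivrMr ?mul1r // lt_def k_neq0.
Qed.

(** The mean of two Gram matrices is the Gram matrix of the block row
    [(P Q) / sqrt 2], so the points of the ellipsoid are
    [c + (P u + Q v) / sqrt 2] with [|u|^2 + |v|^2 <= 1].  Then
    [|u| / sqrt 2 + |v| / sqrt 2 <= 1], which exhibits the point as a convex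
    combination of points of the two given ellipsoids. *)
Lemma mean_ellipsoid_sub d (F : set 'cV[R]_d) (P Q U : 'M[R]_d)
    (a c : 'cV[R]_d) :
  convex_set (F : set (convex_lmodType 'cV[R]_d)) ->
  ellipsoid P c `<=` F -> ellipsoid Q c `<=` F -> orthomx U ->
  U^T *m (2^-1 *: (P *m P^T + Q *m Q^T)) *m U = dmx a *m dmx a ->
  ellipsoid (U *m dmx a) c `<=` F.
Proof.
move=> cvF PF QF oU gramU _ [z /= z1 <-].
pose s : R := Num.sqrt 2^-1; have s_ge0 : 0 <= s := sqrtr_ge0 _.
have ss : s ^+ 2 = 2^-1 by rewrite sqr_sqrtr.
have gramPQ : U^T *m (row_mx (s *: P) (s *: Q) *m (row_mx (s *: P) (s *: Q))^T)
    *m U = dmx a *m dmx a.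
  rewrite -gramU tr_row_mx mul_row_col; congr (_ *m _ *m _).
  have scaleE (X : 'M[R]_d) : (s *: X) *m (s *: X)^T = 2^-1 *: (X *m X^T).
    by rewrite linearZ /= -scalemxAl -scalemxAr scalerA -expr2 ss.
  by rewrite !scaleE scalerDr.
have /seteqP [_ sub] := ball_image_gram oU gramPQ.
have [|x /= x1 <-] := sub (U *m dmx a *m z); first by exists z.
rewrite -[x]vsubmxK mul_row_col; set u := usubmx x; set v := dsubmx x.
have le1 : dotv u u + dotv v v <= 1.
  move: x1; rewrite enorm_le1 -{1 2}[x]vsubmxK.
  by rewrite /dotv tr_col_mx mul_row_col mxE.
pose n1 := Num.sqrt (dotv u u); pose n2 := Num.sqrt (dotv v v).
have n1_ge0 : 0 <= n1 := sqrtr_ge0 _; have n2_ge0 : 0 <= n2 := sqrtr_ge0 _.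
have n11 : n1 ^+ 2 = dotv u u by rewrite sqr_sqrtr ?dotv_ge0.
have n22 : n2 ^+ 2 = dotv v v by rewrite sqr_sqrtr ?dotv_ge0.
have sn : s * n1 + s * n2 <= 1.
  rewrite -mulrDr -(@expr_le1 _ 2) ?mulr_ge0 ?addr_ge0 // exprMn ss.
  have -> : (n1 + n2) ^+ 2 = 2 * (n1 ^+ 2 + n2 ^+ 2) - (n1 - n2) ^+ 2 by ring.
  rewrite n11 n22. have := sqr_ge0 (n1 - n2); lra.
have [y1 y1_le1 y1E] := rescale_ball (k := s * n1) s_ge0 (lexx _).
have [|y2 y2_le1 y2E] := rescale_ball (x := v) (k := 1 - s * n1) s_ge0.
  by rewrite -/n2; lra.
rewrite -!scalemxAl !scalemxAr y1E y2E -!scalemxAr.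
have Fy1 : F (P *m y1 + c) by apply: PF; exists y1.
have Fy2 : F (Q *m y2 + c) by apply: QF; exists y2.
have := convex_set_comb cvF Fy1 Fy2 (l := s * n1) (mulr_ge0 s_ge0 n1_ge0).
rewrite !scalerDr addrACA -scalerDl [s * n1 + _]addrC subrK scale1r; apply.
by have := mulr_ge0 s_ge0 n2_ge0; lra.
Qed.

End EllipsoidGram.

(** * The size of an ellipsoid in terms of its Gram matrix *)

Section Size.
Variable R : realType.

Lemma wpow_half d (x : 'cV[R]_d) i : wpow 2^-1 x i 0 = Num.sqrt `|x i 0|.
Proof. by rewrite mxE powR12_sqrt. Qed.

Lemma wpow_halfK d (x : 'cV[R]_d) : nneg_orthant x ->
  dmx (wpow 2^-1 x) *m dmx (wpow 2^-1 x) = dmx x.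
Proof.
move=> x_ge0; rewrite dmxM; congr dmx; apply/colP => i.
by rewrite !mxE powR12_sqrt // -expr2 sqr_sqrtr // ger0_norm ?x_ge0.
Qed.

Lemma nneg_wpow d p (x : 'cV[R]_d) : nneg_orthant (wpow p x).
Proof. by move=> i; rewrite mxE powR_ge0. Qed.

Lemma char_poly_orth d (U : 'M[R]_d) (a : 'cV[R]_d) : orthomx U ->
  char_poly (U *m dmx a *m U^T) = \prod_i ('X - (a i 0)%:P).
Proof.
move=> oU; pose V := map_mx polyC U.
have oV : V *m V^T = 1%:M.
  by rewrite /V map_trmx -map_mxM orthomx_tr // map_scalar_mx.
have -> : char_poly (U *m dmx a *m U^T) = \det (V *m char_poly_mx (dmx a) *m V^T).
  rewrite /char_poly /char_poly_mx mulmxBr mulmxBl mul_mx_scalar -scalemxAl oV.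
  by rewrite scalemx1 !map_mxM -map_trmx.
rewrite !det_mulmx mulrAC -det_mulmx oV det1 mul1r -/(char_poly _).
rewrite char_poly_trig ?diag_mx_is_trig //.
by apply: eq_bigr => i _; rewrite !mxE eqxx mulr1n.
Qed.

Lemma prod_XsubC_perm d (a b : 'cV[R]_d) :
  \prod_i ('X - (a i 0)%:P) = \prod_i ('X - (b i 0)%:P) ->
  exists s : 'S_d, a = row_perm s b.
Proof.
move=> ab; pose ta := [tuple a i 0 | i < d]; pose tb := [tuple b i 0 | i < d].
have prodE (x : 'cV[R]_d) :
    \prod_i ('X - (x i 0)%:P) = \prod_(y <- [tuple x i 0 | i < d]) ('X - y%:P).
  by rewrite big_tuple; apply: eq_bigr => i _; rewrite tnth_mktuple.
have : perm_eq ta tb by apply: prod_XsubC_eq; rewrite -!prodE ab.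
case/tuple_permP => s ts; exists s; apply/colP => i; rewrite !mxE.
have := congr1 (fun t => nth 0 t i) ts; by rewrite -!tnth_nth !tnth_mktuple.
Qed.

(** The semi-axes are chosen among the eigenvalue vectors of all positive
    semi-definite matrices representing the ellipsoid.  There is only one such
    matrix, the square root [W] of the Gram matrix, and its eigenvalue vectors
    differ by a permutation, which [f] does not see. *)
Lemma ellipsoid_size_gram d (f : 'cV[R]_d -> R) (P U : 'M[R]_d) (c : 'cV[R]_d) :
  size_function f -> orthomx U -> is_diag_mx (U^T *m (P *m P^T) *m U) ->
  ellipsoid_size f (ellipsoid P c) =
  f (wpow 2^-1 (diagv (U^T *m (P *m P^T) *m U))).
Proof.
move=> [_ _ _ symf] oU diagU; set x := diagv _; set a := wpow _ _.
have x_ge0 : nneg_orthant x by apply/psd_diagv/psd_conj/psd_gram.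
have aa : U^T *m (P *m P^T) *m U = dmx a *m dmx a.
  by rewrite wpow_halfK //; exact: is_diag_dmx.
pose W := U *m dmx a *m U^T.
have symW : W^T = W by rewrite /W !trmx_mul trmxK tr_dmx mulmxA.
have UW : U^T *m W = dmx a *m U^T by rewrite /W !mulmxA oU mul1mx.
have WU : W *m U = U *m dmx a by rewrite /W -mulmxA oU mulmx1.
have psdW : psdmx W.
  split=> // y; rewrite /W -!mulmxA mulmxA.
  have -> : y^T *m U = (U^T *m y)^T by rewrite trmx_mul trmxK.
  rewrite -/(dotv _ _) dotvE sumr_ge0 // => i _; rewrite dmx_mulmx mulrCA.
  by rewrite mulr_ge0 -?expr2 ?sqr_ge0 ?nneg_wpow.
have PW : ellipsoid P c = ellipsoid W c.
  rewrite (ellipsoid_gram c oU aa); symmetry; apply: ellipsoid_gram => //.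
  by rewrite symW mulmxA UW -mulmxA WU !mulmxA -(mulmxA _ U^T) oU mulmx1.
have axa : is_semi_axes (ellipsoid P c) a.
  by exists W, c; split=> //; exact: char_poly_orth.
rewrite /ellipsoid_size /semi_axes.
have [P' [t [psdP']]] := xgetPex 0 (ex_intro _ _ axa).
rewrite PW => /ellipsoid_inj [_]; rewrite symW psdP'.1.
move=> /(psd_sqrt_inj psdW psdP') <-; rewrite char_poly_orth //.
move=> /esym /prod_XsubC_perm [s ->].
by rewrite symf //; exact: nneg_wpow.
Qed.

End Size.

(** * Continuity and compactness in spaces of matrices *)

Section MatrixTopology.
Variable R : realType.

Lemma continuous_mx (T : topologicalType) m n (F : T -> 'M[R]_(m, n)) :
  (forall i j, continuous (fun x => F x i j)) -> continuous F.
Proof.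
move=> cF x A [P nP sPA]; rewrite /= /nbhs /=.
have : \forall y \near x, forall ij : 'I_m * 'I_n, P ij.1 ij.2 (F y ij.1 ij.2).
  by apply: filter_forall => -[i j] /=; exact: (cF i j x _ (nP i j)).
by apply: filterS => y Py; apply: sPA => i j; exact: (Py (i, j)).
Qed.

Lemma continuous_coord (T : topologicalType) m n (F : T -> 'M[R]_(m, n)) i j :
  continuous F -> continuous (fun x => F x i j).
Proof.
by move=> cF x; apply: (cvg_comp _ (fun M : 'M[R]__ => M i j) (cF x));
   exact: coord_continuous.
Qed.

Lemma continuous_trmx (T : topologicalType) m n (F : T -> 'M[R]_(m, n)) :
  continuous F -> continuous (fun x => (F x)^T).
Proof.
move=> cF; apply: continuous_mx => i j.
rewrite (_ : (fun x => (F x)^T i j) = (fun x => F x j i)).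
  exact: continuous_coord.
by apply/funext => x; rewrite mxE.
Qed.

Lemma continuous_mulmx (T : topologicalType) m n p
    (F : T -> 'M[R]_(m, n)) (G : T -> 'M[R]_(n, p)) :
  continuous F -> continuous G -> continuous (fun x => F x *m G x).
Proof.
move=> cF cG; apply: continuous_mx => i j.
rewrite (_ : (fun x => _) = (fun x => \sum_k F x i k * G x k j)); last first.
  by apply/funext => x; rewrite mxE.
move=> x; apply: cvg_big => [|k _]; first exact: add_continuous.
by apply: cvgM; apply: continuous_coord.
Qed.

Lemma continuous_dmx (T : topologicalType) d (F : T -> 'cV[R]_d) :
  continuous F -> continuous (fun x => dmx (F x)).
Proof.
move=> cF; apply: continuous_mx => i j.
rewrite (_ : (fun x => _) = (fun x => F x i 0 *+ (i == j))); last first.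
  by apply/funext => x; rewrite !mxE; case: eqP => // ->.
case: eqP => _; last exact: cst_continuous.
exact: continuous_coord.
Qed.

Lemma continuous_diagv (T : topologicalType) d (F : T -> 'M[R]_d) :
  continuous F -> continuous (fun x => diagv (F x)).
Proof.
move=> cF; apply: continuous_mx => i j.
rewrite (_ : (fun x => _) = (fun x => F x i i)); last first.
  by apply/funext => x; rewrite mxE.
exact: continuous_coord.
Qed.

Lemma continuous_wpow_half (T : topologicalType) d (F : T -> 'cV[R]_d) :
  continuous F -> continuous (fun x => wpow 2^-1 (F x)).
Proof.
move=> cF; apply: continuous_mx => i j; rewrite ord1.
rewrite (_ : (fun x => _) = (fun x => Num.sqrt `|F x i 0|)); last first.
  by apply/funext => x; rewrite wpow_half.
move=> x; apply: (cvg_comp _ Num.sqrt); last exact: sqrt_continuous.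
by apply: cvg_norm; exact: continuous_coord.
Qed.

(** Continuity on a subset suffices for a composition that never leaves it; this
    turns functions on the orthant into continuous functions of matrices. *)
Lemma continuous_within_comp (S T U : topologicalType) (D : set T)
    (f : T -> U) (h : S -> T) :
  {within D, continuous f} -> continuous h -> (forall x, D (h x)) ->
  continuous (f \o h).
Proof.
move=> /subspace_continuousP cf ch Dh x; apply: cvg_comp (cf _ (Dh x)).
move=> A nA; have hA : nbhs x (fun z => D (h z) -> A (h z)) := ch x _ nA.
by apply: (filterS (F := nbhs x)) hA => z; apply; exact: Dh.
Qed.

(** Tychonoff's theorem for row vectors, transported along [vec_mx]. *)
Lemma compact_box m n (K : R) :
  compact [set M : 'M[R]_(m, n) | forall i j, `|M i j| <= K].
Proof.
pose vec := fun v : 'rV[R]_(m * n) => vec_mx v.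
have cvec : continuous vec.
  apply: continuous_mx => i j.
  rewrite (_ : (fun x => _) = (fun v : 'rV[R]_(m * n) => v 0 (mxvec_index i j))).
    exact: coord_continuous.
  by apply/funext => v; rewrite /vec mxE.
rewrite (_ : mkset _ = vec @` [set v : 'rV[R]_(m * n) |
                                forall k, `[- K, K]%classic (v 0 k)]).
  apply: continuous_compact; first exact: continuous_subspaceT.
  apply: (@rV_compact R _ (fun=> `[- K, K]%classic)) => _.
  exact: segment_compact.
apply/seteqP; split=> [M MK|_ [v vK <-] i j].
  exists (mxvec M); last by rewrite /vec mxvecK.
  move=> k; have [i j] := mxvec_indexP k.
  by rewrite mxvecE /= in_itv /= -ler_norml.
by rewrite /vec mxE ler_norml; have := vK (mxvec_index i j); rewrite /= in_itv.
Qed.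

Lemma compact_orthomx d : compact [set U : 'M[R]_d | orthomx U].
Proof.
apply: (subclosed_compact _ (@compact_box d d 1)) => [|U oU i j].
  rewrite (_ : mkset _ = (fun U : 'M[R]_d => U^T *m U) @^-1` [set 1%:M]) //.
  have cUU : continuous (fun U : 'M[R]_d => U^T *m U).
    have cid : continuous (fun U : 'M[R]_d => U) by move=> U.
    by apply: continuous_mulmx => //; exact: continuous_trmx.
  apply: closed_comp; first by move=> U _; exact: cUU.
  apply: compact_closed; [exact: norm_hausdorff | exact: compact_set1].
have := congr1 (fun M : 'M[R]_d => M j j) oU.
rewrite !mxE eqxx (bigD1 i) //= mxE => h.
have : U i j ^+ 2 <= 1.
  rewrite -[leRHS]/(true%:R) -h expr2 lerDl sumr_ge0 // => k _.
  by rewrite mxE -expr2 sqr_ge0.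
by rewrite -[X in _ <= X](expr1n _ 2) -real_normK ?num_real // ler_pXn2r ?nnegrE.
Qed.

Lemma compact_dotv_bounded d (F : set 'cV[R]_d) (c : 'cV[R]_d) :
  compact F -> exists K : R, forall y, F y -> dotv (y - c) (y - c) <= K.
Proof.
move=> cptF; have [[y0 Fy0]|noF] := pselect (F !=set0); last first.
  by exists 0 => y Fy; case: noF; exists y.
have ctsn : continuous (fun y : 'cV[R]_d => dotv (y - c) (y - c)).
  have ctsB : continuous (fun y : 'cV[R]_d => y - c).
    have cid : continuous (fun y : 'cV[R]_d => y) by move=> y.
    move=> y; apply: (@continuousB _ 'cV[R]_d _ id (cst c)).
      exact: cid.
    exact: cst_continuous.
  apply: continuous_coord; apply: (continuous_mulmx _ ctsB).
  exact: continuous_trmx ctsB.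
have [|y Fy maxy] := compact_EVT_max _ cptF (continuous_subspaceT ctsn).
  by exists y0.
by exists (dotv (y - c) (y - c)) => y' Fy'; apply: maxy; rewrite inE.
Qed.

End MatrixTopology.

(** * Strictly concave symmetric functions of the diagonal *)

Section Davis.
Variable R : realType.

(** The Householder reflection in the hyperplane orthogonal to [v]: an
    orthogonal matrix with rational entries in [v], which spares the square
    roots of a normalised plane rotation. *)
Definition reflmx d (v : 'cV[R]_d) : 'M[R]_d :=
  1%:M - (2 / dotv v v) *: (v *m v^T).

Lemma tr_reflmx d (v : 'cV[R]_d) : (reflmx v)^T = reflmx v.
Proof.
by rewrite /reflmx linearB linearZ /= trmx1 trmx_mul trmxK.
Qed.

Lemma orthomx_reflmx d (v : 'cV[R]_d) : v != 0 -> orthomx (reflmx v).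
Proof.
move=> v0; have vv0 : dotv v v != 0 by apply: contra_neq v0 => /dotv_eq0.
rewrite /orthomx tr_reflmx; set w := 2 / dotv v v.
have vvv : (v *m v^T) *m (v *m v^T) = dotv v v *: (v *m v^T).
  rewrite mulmxA -(mulmxA v) (mx11_scalar (v^T *m v)) -/(dotv v v).
  by rewrite mul_mx_scalar -scalemxAl.
rewrite /reflmx -/w mulmxBl mul1mx mulmxBr mulmx1 -scalemxAl -scalemxAr vvv.
rewrite !scalerA (_ : w * w * dotv v v = w + w); last by rewrite /w; field.
by rewrite scalerDl opprB addrK subrK.
Qed.

Lemma reflmx_conj_diag d (v : 'cV[R]_d) (M : 'M[R]_d) k : M^T = M ->
  let w := 2 / dotv v v in
  (reflmx v *m M *m reflmx v) k k =
  M k k - 2 * w * v k 0 * (M *m v) k 0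
  + w ^+ 2 * v k 0 ^+ 2 * dotv v (M *m v).
Proof.
move=> symM w.
have rE : reflmx v *m delta_mx k 0 = delta_mx k 0 - (w * v k 0) *: v.
  rewrite mulmxBl mul1mx -scalemxAl -mulmxA; congr (_ - _).
  rewrite (mx11_scalar (v^T *m _)) mul_mx_scalar scalerA; congr (_ * _ *: _).
  by rewrite -colE !mxE.
rewrite -[LHS]dotv_delta -!mulmxA -{1}tr_reflmx -dotv_mulmxl rE.
rewrite -(scaleNr _ v) mulmxDr -scalemxAr !(dotvDl, dotvDr, dotvZl, dotvZr) dotv_delta.
have -> : dotv (delta_mx k 0) (M *m v) = (M *m v) k 0.
  by rewrite /dotv trmx_delta -rowE mxE.
have -> : dotv v (M *m delta_mx k 0) = (M *m v) k 0.
  by rewrite dotvC dotv_mulmxl symM /dotv trmx_delta -rowE mxE.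
ring.
Qed.

(** A small angle suffices: a nonzero off-diagonal entry makes the larger of
    the two diagonal entries grow to first order in the angle, against a loss
    of second order.  The trace is invariant, so the other entry decreases by
    the same amount. *)
Lemma diag_spread d (M : 'M[R]_d) i j : M^T = M -> i != j -> M i j != 0 ->
  M j j <= M i i ->
  exists2 H : 'M[R]_d, orthomx H &
    let b := diagv (H^T *m M *m H) in
    [/\ M i i < b i 0, b i 0 + b j 0 = M i i + M j j &
        forall k, k != i -> k != j -> b k 0 = M k k].
Proof.
move=> symM ij m0 qp; set p := M i i in qp *; set q := M j j in qp *.
set m := M i j in m0.
(* [t] is the tangent of half the angle.  It must have the sign of [m], and
   the gain is positive as soon as [t ^+ 2 + s * (p - q) < 1]; the denominator
   of [s] ensures this. *)
pose s := (1 + m ^+ 2 + (p - q))^-1; pose t := s * m.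
pose v : 'cV[R]_d := delta_mx j 0 - t *: delta_mx i 0.
have vi : v i 0 = - t by rewrite !mxE !eqxx (negbTE ij) /= mulr1 sub0r.
have vj : v j 0 = 1.
  by rewrite !mxE !eqxx eq_sym (negbTE ij) /= mulr0 subr0.
have vk k : k != i -> k != j -> v k 0 = 0.
  by move=> /negbTE ki /negbTE kj; rewrite !mxE ki kj /= mulr0 subr0.
have Mji : M j i = m by rewrite /m -[in RHS]symM mxE.
have Mv k : (M *m v) k 0 = M k j - t * M k i.
  by rewrite mulmxBr -scalemxAr -!colE !mxE.
have dotvr u : dotv v u = u j 0 - t * u i 0.
  by rewrite /v -scaleNr dotvDl dotvZl /dotv !trmx_delta -!rowE !mxE mulNr.
have vv : dotv v v = 1 + t ^+ 2 by rewrite dotvr vi vj; ring.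
have v0 : v != 0.
  by apply/eqP => /colP /(_ j); rewrite vj mxE; apply/eqP/oner_neq0.
have vMv : dotv v (M *m v) = q - 2 * t * m + t ^+ 2 * p.
  by rewrite dotvr !Mv Mji -/p -/q -/m; ring.
exists (reflmx v); first exact: orthomx_reflmx.
rewrite tr_reflmx; set b := diagv _.
have bE k : b k 0 = M k k - 2 * (2 / (1 + t ^+ 2)) * v k 0 * (M k j - t * M k i)
    + (2 / (1 + t ^+ 2)) ^+ 2 * v k 0 ^+ 2 * (q - 2 * t * m + t ^+ 2 * p).
  by rewrite mxE reflmx_conj_diag // vv vMv Mv.
have t1 : 1 + t ^+ 2 != 0 by rewrite gt_eqF // ltr_pwDl ?sqr_ge0.
split.
- rewrite bE vi -/p -/m -subr_gt0.
  set e := (X in 0 < X).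
  have -> : e = 4 * s * m ^+ 2 * (1 - t ^+ 2 - s * (p - q)) / (1 + t ^+ 2) ^+ 2.
    by rewrite /e /t; field; exact: t1.
  have m2 : 0 < m ^+ 2 by rewrite lt_def sqrf_eq0 m0 sqr_ge0.
  have pq : 0 <= p - q by rewrite subr_ge0.
  have D1 : 0 < 1 + m ^+ 2 + (p - q) by lra.
  have s0 : 0 < s by rewrite invr_gt0.
  have sE : s + s * m ^+ 2 + s * (p - q) = 1.
    by rewrite -{1}[s]mulr1 -!mulrDr mulVf // gt_eqF.
  have sm : 0 <= s * m ^+ 2 by rewrite mulr_ge0 // ltW.
  have spq : 0 <= s * (p - q) by rewrite mulr_ge0 // ltW.
  have s1 : s <= 1 by lra.
  have tm : t ^+ 2 <= s * m ^+ 2.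
    by rewrite /t exprMn expr2 -mulrA -[leRHS]mul1r ler_pM // ltW.
  have gt0 : 0 < 1 - t ^+ 2 - s * (p - q) by lra.
  have t2 : 0 < 1 + t ^+ 2 by rewrite ltr_pwDl ?sqr_ge0.
  have s4 : 0 < 4 * s by lra.
  apply: divr_gt0; last exact: exprn_gt0.
  by apply: mulr_gt0 => //; exact: mulr_gt0.
- by rewrite !bE vi vj Mji -/p -/q -/m; field.
- move=> k ki kj; rewrite bE vk // mulr0 mul0r expr0n /=.
  by rewrite mulr0 mul0r subr0 addr0.
Qed.

Variables (d : nat) (g : 'cV[R]_d -> R).
Hypothesis g_sym : forall x (s : 'S_d), nneg_orthant x -> g (row_perm s x) = g x.
Hypothesis g_cts : {within @nneg_orthant R d, continuous g}.
Hypothesis g_conc : strictly_concave_on (@nneg_orthant R d) g.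

(** The diagonal of [M] lies strictly between the spread diagonal [b] and its
    image [b'] under the transposition of [i] and [j]; [g] takes the same value
    at [b] and [b'], and a larger one strictly between them. *)
Lemma diag_spread_lt (M : 'M[R]_d) : psdmx M -> ~~ is_diag_mx M ->
  exists2 H : 'M[R]_d, orthomx H &
    g (diagv (H^T *m M *m H)) < g (diagv M).
Proof.
move=> psdM; have [symM _] := psdM.
have lt_of_entry i j : i != j -> M i j != 0 -> M j j <= M i i ->
    exists2 H : 'M[R]_d, orthomx H & g (diagv (H^T *m M *m H)) < g (diagv M).
  move=> ij m0 le_ji; have [H oH] := diag_spread symM ij m0 le_ji.
  set b := diagv (H^T *m M *m H) => -[lt_i sum_ij eq_k]; exists H => //.
  have b_ge0 : nneg_orthant b by apply/psd_diagv/psd_conj.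
  rewrite -/b; clearbody b.
  set b' := row_perm (tperm i j) b.
  have b'E k : b' k 0 = b (tperm i j k) 0 by rewrite mxE.
  have b'_ge0 : nneg_orthant b' by move=> k; rewrite b'E.
  have b'b : b <> b'.
    move=> /colP /(_ i); rewrite b'E tpermL => bij.
    have : b j 0 < b i 0 by lra.
    by rewrite bij ltxx.
  have den_gt0 : 0 < b i 0 - b j 0 by lra.
  (* The weight of [b], read off from the coordinate [i]. *)
  pose l := (M i i - b j 0) / (b i 0 - b j 0).
  have l_gt0 : 0 < l by rewrite divr_gt0 //; lra.
  have l_lt1 : l < 1 by rewrite ltr_pdivrMr //; lra.
  have lE : l * (b i 0 - b j 0) = M i i - b j 0 by rewrite divfK // gt_eqF.
  have := g_conc b_ge0 b'_ge0 b'b l_gt0 l_lt1.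
  rewrite g_sym // -mulrDl addrC subrK mul1r.
  rewrite (_ : _ + _ = diagv M) //; apply/colP => k; rewrite !mxE.
  have [->|ki] := eqVneq k i.
    by rewrite tpermL; lra.
  have [->|kj] := eqVneq k j.
    by rewrite tpermR; lra.
  by rewrite tpermD 1?eq_sym // eq_k //; ring.
case/forallPn => i /forallPn [j]; rewrite negb_imply => /andP [ij m0].
have [|/ltW] := leP (M j j) (M i i); first exact: lt_of_entry.
by apply: lt_of_entry; [rewrite eq_sym|rewrite -symM mxE].
Qed.

Lemma diag_minimizer (A Q : 'M[R]_d) : psdmx A -> orthomx Q ->
  (forall Q', orthomx Q' ->
     g (diagv (Q^T *m A *m Q)) <= g (diagv (Q'^T *m A *m Q'))) ->
  is_diag_mx (Q^T *m A *m Q).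
Proof.
move=> psdA oQ minQ; apply: contrapT => /negP.
case/(diag_spread_lt (psd_conj _ psdA)) => H oH.
have := minQ (Q *m H) (orthomxM oQ oH); rewrite trmx_mul !mulmxA => le1.
by rewrite ltNge le1.
Qed.

Lemma exists_diag_minimizer (A : 'M[R]_d) : psdmx A ->
  exists2 V, orthomx V & forall Q, orthomx Q ->
    g (diagv (V^T *m A *m V)) <= g (diagv (Q^T *m A *m Q)).
Proof.
move=> psdA; pose h := fun Q : 'M[R]_d => diagv (Q^T *m A *m Q).
have ch : continuous h.
  have cid : continuous (fun U : 'M[R]_d => U) by move=> U.
  apply: continuous_diagv; apply: continuous_mulmx => //.
  apply: continuous_mulmx; first exact: continuous_trmx.
  exact: cst_continuous.
have cgh : continuous (g \o h).
  by apply: continuous_within_comp g_cts ch _ => Q; exact/psd_diagv/psd_conj.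
have [|V oV minV] := compact_EVT_min _ (@compact_orthomx R d)
                                     (continuous_subspaceT cgh).
  by exists 1%:M; rewrite /= /orthomx trmx1 mulmx1.
exists V => [|Q oQ]; first by move: oV; rewrite inE.
by apply: minV; rewrite inE.
Qed.

Lemma psd_diagonalizable (A : 'M[R]_d) : psdmx A ->
  exists2 V, orthomx V & is_diag_mx (V^T *m A *m V).
Proof.
move=> psdA; have [V oV minV] := exists_diag_minimizer psdA.
by exists V => //; exact: diag_minimizer.
Qed.

End Davis.

(** * Existence and uniqueness of the maximal ellipsoid *)

Section MaximalEllipsoid.
Variables (R : realType) (d : nat) (f : 'cV[R]_d -> R) (F : set 'cV[R]_d).
Variable (c : 'cV[R]_d).
Hypothesis sf : size_function f.
Hypothesis f_conc : strictly_concave_on (@nneg_orthant R d) (f \o wpow (2^-1)).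
Hypothesis bodyF : convex_body F.

Let g := f \o wpow (2^-1).

Lemma size_sqrt_sym x (s : 'S_d) : nneg_orthant x -> g (row_perm s x) = g x.
Proof.
move=> x_ge0; have [_ _ _ symf] := sf.
rewrite /g /= -(symf (wpow 2^-1 x) s); last exact: nneg_wpow.
by congr f; apply/colP => i; rewrite !mxE.
Qed.

Lemma size_sqrt_continuous : continuous g.
Proof.
have [_ ctsf _ _] := sf; apply: continuous_within_comp ctsf _ _.
  by apply: continuous_wpow_half => x.
exact: nneg_wpow.
Qed.

Let g_within : {within @nneg_orthant R d, continuous g} :=
  continuous_subspaceT size_sqrt_continuous.

Let gram_diagonalizable (A : 'M[R]_d) : psdmx A ->
  exists2 V, orthomx V & is_diag_mx (V^T *m A *m V) :=
  psd_diagonalizable size_sqrt_sym g_within f_conc (A := A).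

Lemma ellipsoid_size_le_diag (P Q : 'M[R]_d) : orthomx Q ->
  ellipsoid_size f (ellipsoid P c) <= g (diagv (Q^T *m (P *m P^T) *m Q)).
Proof.
move=> oQ; have psdA := psd_gram P.
have [V oV minV] := exists_diag_minimizer g_within psdA.
have diagV := diag_minimizer size_sqrt_sym f_conc psdA oV minV.
by rewrite (ellipsoid_size_gram c sf oV diagV); exact: minV.
Qed.

(** The parameter set is closed because containment in [F] is a condition on
    each point of the unit ball separately, and bounded because the points
    [c + a_i U e_i] lie in [F].  The entries of [a] carry a sign, which the
    size, a function of their squares, does not see. *)
Lemma exists_maximal_parameters : F c ->
  exists U a, [/\ orthomx U, ellipsoid (U *m dmx a) c `<=` F &
    forall V b, orthomx V -> ellipsoid (V *m dmx b) c `<=` F ->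
      g (diagv (dmx b *m dmx b)) <= g (diagv (dmx a *m dmx a))].
Proof.
move=> Fc; have [cptF _ _] := bodyF; have [K bndK] := compact_dotv_bounded c cptF.
have clF : closed F by apply: compact_closed cptF; exact: norm_hausdorff.
pose pt x (Ua : 'M[R]_d * 'cV[R]_d) := Ua.1 *m dmx Ua.2 *m x + c.
have cts1 : continuous (fun Ua : 'M[R]_d * 'cV[R]_d => Ua.1).
  by move=> Ua; exact: cvg_fst.
have cts2 : continuous (fun Ua : 'M[R]_d * 'cV[R]_d => Ua.2).
  by move=> Ua; exact: cvg_snd.
have ctspt x : continuous (pt x).
  have cts : continuous (fun Ua : 'M[R]_d * 'cV[R]_d => Ua.1 *m dmx Ua.2 *m x).
    apply: continuous_mulmx; last exact: cst_continuous.
    by apply: continuous_mulmx => //; exact: continuous_dmx.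
  by move=> Ua; apply: cvgD; [exact: cts | exact: cvg_cst].
pose C := \bigcap_(x in [set x : 'cV[R]_d | enorm x <= 1]) (pt x @^-1` F).
pose D := [set U : 'M[R]_d | orthomx U] `*`
          [set a : 'cV[R]_d | forall i j, `|a i j| <= K + 1].
have cptK : compact (D `&` C).
  apply: compact_closedI.
    by apply: compact_setX; [exact: compact_orthomx | exact: compact_box].
  apply: closed_bigI => x _; apply: closed_comp clF => Ua _; exact: ctspt.
have inK U a : orthomx U -> ellipsoid (U *m dmx a) c `<=` F -> (D `&` C) (U, a).
  move=> oU EF; split; last by move=> x x1; apply: EF; exists x.
  split=> //= i j; rewrite ord1.
  have e1 : enorm (delta_mx i 0 : 'cV[R]_d) <= 1.
    by rewrite enorm_le1 -[X in dotv _ X]mul1mx dotv_delta mxE eqxx.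
  have /bndK : F (U *m dmx a *m delta_mx i 0 + c) by apply: EF; exists (delta_mx i 0).
  rewrite addrK -mulmxA orthomx_dotv // dotv_mulmxl tr_dmx mulmxA dmxM dotv_delta.
  rewrite !mxE eqxx mulr1n -expr2 -real_normK ?num_real //.
  (* [r ^+ 2 <= K] gives [r <= K + 1]. *)
  by have := normr_ge0 (a i 0); nra.
have ctsobj : continuous (fun Ua : 'M[R]_d * 'cV[R]_d =>
    g (diagv (dmx Ua.2 *m dmx Ua.2))).
  have cts : continuous (fun Ua : 'M[R]_d * 'cV[R]_d =>
      diagv (dmx Ua.2 *m dmx Ua.2)).
    by apply: continuous_diagv; apply: continuous_mulmx; exact: continuous_dmx.
  by move=> Ua; apply: continuous_comp (cts Ua) (@size_sqrt_continuous _).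
have [|[U a] KUa maxUa] := compact_EVT_max _ cptK (continuous_subspaceT ctsobj).
  exists (1%:M, 0); apply: inK; first by rewrite /orthomx trmx1 mulmx1.
  move=> _ [x _ <-]; rewrite mul1mx (_ : dmx 0 = 0) ?mul0mx ?add0r //.
  by rewrite /dmx trmx0 linear0.
move: KUa; rewrite inE => -[[/= oU _] CUa]; exists U, a; split=> //.
  by move=> _ [x x1 <-]; exact: CUa.
by move=> V b oV VF; apply: (maxUa (V, b)); rewrite inE; exact: inK.
Qed.

Lemma size_orth_dmx (U : 'M[R]_d) a : orthomx U ->
  ellipsoid_size f (ellipsoid (U *m dmx a) c) = g (diagv (dmx a *m dmx a)).
Proof.
move=> oU; rewrite (ellipsoid_size_gram c sf oU) gram_dmx //.
by rewrite dmxM diag_mx_is_diag.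
Qed.

Definition maximal_ellipsoid (E : set 'cV[R]_d) : Prop :=
  [/\ is_ellipsoid c E, E `<=` F &
      forall E' : set 'cV[R]_d, is_ellipsoid c E' -> E' `<=` F ->
        ellipsoid_size f E' <= ellipsoid_size f E].

Lemma exists_maximal_ellipsoid : F c -> exists E, maximal_ellipsoid E.
Proof.
move=> /exists_maximal_parameters [U [a [oU EF maxE]]].
exists (ellipsoid (U *m dmx a) c); split=> //; first by exists (U *m dmx a).
move=> _ [P ->] PF; have [V oV diagV] := gram_diagonalizable (psd_gram P).
have := is_diag_dmx diagV; set x := diagv _ => xE.
have x_ge0 : nneg_orthant x by apply/psd_diagv/psd_conj/psd_gram.
have PE := ellipsoid_gram c oV (etrans xE (esym (wpow_halfK x_ge0))).
by rewrite PE !size_orth_dmx //; apply: (maxE V); rewrite -?PE.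
Qed.

Lemma maximal_ellipsoid_unique E1 E2 :
  maximal_ellipsoid E1 -> maximal_ellipsoid E2 -> E1 = E2.
Proof.
move=> [[P1 ->] P1F max1] [[P2 ->] P2F max2].
set A1 := P1 *m P1^T; set A2 := P2 *m P2^T.
pose A := 2^-1 *: (A1 + A2).
have psdA : psdmx A.
  have [sym1 pos1] : psdmx A1 := psd_gram P1.
  have [sym2 pos2] : psdmx A2 := psd_gram P2.
  split=> [|x]; first by rewrite linearZ linearD /= sym1 sym2.
  rewrite -scalemxAr mulmxDr -scalemxAl mulmxDl mxE [X in _ * X]mxE.
  by rewrite mulr_ge0 ?addr_ge0 // ?pos1 ?pos2.
have [U oU diagU] := gram_diagonalizable psdA.
set x := diagv (U^T *m A *m U).
set b1 := diagv (U^T *m A1 *m U); set b2 := diagv (U^T *m A2 *m U).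
have x_ge0 : nneg_orthant x by exact/psd_diagv/psd_conj.
have b1_ge0 : nneg_orthant b1 by exact/psd_diagv/psd_conj/psd_gram.
have b2_ge0 : nneg_orthant b2 by exact/psd_diagv/psd_conj/psd_gram.
have xE : x = 2^-1 *: b1 + (1 - 2^-1) *: b2.
  have -> : 1 - 2^-1 = 2^-1 :> R by lra.
  apply/colP => i; rewrite /x /A -scalemxAr mulmxDr -scalemxAl mulmxDl.
  by rewrite [LHS]mxE [LHS]mxE [X in _ * X]mxE mulrDr !mxE.
have gramU : U^T *m A *m U = dmx (wpow 2^-1 x) *m dmx (wpow 2^-1 x).
  by rewrite wpow_halfK //; exact: is_diag_dmx.
have [_ cvF _] := bodyF.
have E3F := mean_ellipsoid_sub cvF P1F P2F oU gramU.
have isE3 : is_ellipsoid c (ellipsoid (U *m dmx (wpow 2^-1 x)) c) by eexists.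
have le1 := max1 _ isE3 E3F; have le2 := max2 _ isE3 E3F.
rewrite size_orth_dmx // -gramU -/x in le1 le2.
have ge1 := ellipsoid_size_le_diag P1 oU.
have ge2 := ellipsoid_size_le_diag P2 oU.
rewrite -/A1 -/b1 in ge1; rewrite -/A2 -/b2 in ge2.
have b12 : b1 = b2.
  apply: contrapT => neq.
  have half_gt0 : 0 < 2^-1 :> R by lra.
  have half_lt1 : 2^-1 < 1 :> R by lra.
  have := f_conc b1_ge0 b2_ge0 neq half_gt0 half_lt1.
  by rewrite -xE -/g; lra.
have xb1 : x = b1.
  by rewrite xE -b12 -scalerDl addrC subrK scale1r.
(* [g x] is at most the size, hence minimal among the values of [g] at the
   diagonals of the conjugates of the Gram matrix: [U] diagonalises it. *)
have ellE P : x = diagv (U^T *m (P *m P^T) *m U) ->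
    g x <= ellipsoid_size f (ellipsoid P c) ->
    ellipsoid P c = ellipsoid (U *m dmx (wpow 2^-1 x)) c.
  move=> xP le_size; apply: ellipsoid_gram => //.
  rewrite wpow_halfK // xP; apply: is_diag_dmx.
  apply: (diag_minimizer size_sqrt_sym f_conc (psd_gram P) oU) => Q oQ.
  by rewrite -xP; apply: le_trans le_size (ellipsoid_size_le_diag P oQ).
by rewrite (ellE P1) // (ellE P2) // xb1.
Qed.

End MaximalEllipsoid.

Theorem theorem14 (R : realType) (d : nat) (f : 'cV[R]_d -> R)
    (F : set 'cV[R]_d) (c : 'cV[R]_d)
    (hf : size_function f)
    (hconc : strictly_concave_on (@nneg_orthant R d) (f \o wpow (2^-1)))
    (hF : convex_body F) (hc : F c) :
  exists! E : set 'cV[R]_d,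
    [/\ is_ellipsoid c E, E `<=` F &
        forall E' : set 'cV[R]_d, is_ellipsoid c E' -> E' `<=` F ->
          ellipsoid_size f E' <= ellipsoid_size f E].
Proof.
have [E maxE] := exists_maximal_ellipsoid hf hconc hF hc.
by exists E; split=> // E'; exact: maximal_ellipsoid_unique hf hconc hF _ _ maxE.
Qed.
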